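(* Let $(P,\preceq)$ be an infinite, locally finite lattice, let $f:P\to\mathbb{R}$, and let $x_1,\dots,x_n$ be distinct elements of $P$ such that $x_i\preceq x_j$ implies $i\le j$; put $S_n=\{x_1,\dots,x_n\}$. If $x_1=\min S_n$, the Hasse diagram of $(S_n,\preceq)$ (as an undirected graph) is a tree, and the meet matrix $(S_n)_f$ is positive definite, then $f$ is strictly order-preserving in $S_n$ (i.e. $x_i\prec x_j$ implies $f(x_i)<f(x_j)$ for $x_i,x_j\in S_n$) and $f(x_i)>0$ for all $x_i\in S_n$.
   Context: The meet matrix $(S_n)_f$ is the $n\times n$ real symmetric matrix with $(i,j)$ entry $f(x_i\wedge x_j)$, where $\wedge$ is the meet in $P$. $x\prec y$ means $x\preceq y$ and $x\ne y$. *)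

(* Defs.v *)
From HB Require Import structures.
From mathcomp Require Import all_boot all_order all_algebra.
From mathcomp Require Import classical_sets cardinality reals.

Set Implicit Arguments.
Unset Strict Implicit.
Unset Printing Implicit Defensive.

Import Order.TTheory GRing.Theory Num.Theory.

Local Open Scope classical_set_scope.
Local Open Scope ring_scope.

Definition infinite_carrier (d : Order.disp_t) (P : porderType d) : Prop :=
  infinite_set [set: P].

Definition locally_finite (d : Order.disp_t) (P : porderType d) : Prop :=
  forall a b : P, finite_set [set z : P | (a <= z <= b)%O].

(* A simple graph on T is a symmetric irreflexive relation. For such a
   relation, a duplicate-free closed walk of length at least 3 is a cycle of
   the graph; shorter ones are not ([:: u; v] just runs an edge back and
   forth). *)
Definition acyclic_graph (T : finType) (e : rel T) : Prop :=
  forall c : seq T, ucycle e c -> (size c <= 2)%N.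

Definition connected_graph (T : finType) (e : rel T) : Prop :=
  (0 < #|T|)%N /\ forall u v : T, connect e u v.

Definition is_tree (T : finType) (e : rel T) : Prop :=
  [/\ symmetric e, irreflexive e, connected_graph e & acyclic_graph e].

(* The covering relation is the one of the finite subposet {x i | i}, not the
   one of P. For injective x the vertices of this subposet are identified with
   their indices. *)
Definition sub_covers (d : Order.disp_t) (P : porderType d) (n : nat)
    (x : 'I_n -> P) : rel 'I_n :=
  fun i j => (x i < x j)%O && ~~ [exists k : 'I_n, (x i < x k < x j)%O].

Definition hasse_graph (d : Order.disp_t) (P : porderType d) (n : nat)
    (x : 'I_n -> P) : rel 'I_n :=
  fun i j => sub_covers x i j || sub_covers x j i.

(* The meet is taken in P, so x i `&` x j need not be one of the x k. *)
Definition meet_matrix (R : realType) (d : Order.disp_t) (P : latticeType d)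
    (f : P -> R) (n : nat) (x : 'I_n -> P) : 'M[R]_n :=
  \matrix_(i < n, j < n) f (x i `&` x j)%O.

Definition posdefmx (R : realType) (n : nat) (A : 'M[R]_n) : Prop :=
  A^T = A /\ forall v : 'cV[R]_n, v != 0 -> 0 < (v^T *m A *m v) 0 0.

(* Main.v *)
Require Import Defs.
From HB Require Import structures.
From mathcomp Require Import all_boot all_order all_algebra.
From mathcomp Require Import classical_sets cardinality reals.
From mathcomp Require Import lra.

Set Implicit Arguments.
Unset Strict Implicit.
Unset Printing Implicit Defensive.

Import Order.TTheory GRing.Theory Num.Theory.

Local Open Scope ring_scope.

(** The quadratic form of the meet matrix is evaluated at two kinds of vectors. At a basis vector
    [e_i] it gives the diagonal entry [f (x i)], hence positivity. If [x i < x j], the meet of the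
    two is [x i], so at [e_i - e_j] the form is [f (x i) - 2 f (x i) + f (x j) = f (x j) - f (x i)],
    which is therefore positive. *)

Lemma delta_mx_form (R : realType) (n : nat) (A : 'M[R]_n) (i j : 'I_n) :
  ((delta_mx i 0 : 'cV[R]_n)^T *m A *m (delta_mx j 0 : 'cV[R]_n)) 0 0 = A i j.
Proof. by rewrite trmx_delta -rowE -colE !mxE. Qed.

Lemma posdefmx_diag_gt0 (R : realType) (n : nat) (A : 'M[R]_n) (i : 'I_n) :
  posdefmx A -> 0 < A i i.
Proof.
case=> _ posA; rewrite -delta_mx_form; apply: posA.
by apply/eqP => /matrixP/(_ i 0); rewrite !mxE !eqxx => /eqP; rewrite oner_eq0.
Qed.

(** By symmetry of [A], the form at [e_i - e_j] equals [A i i - 2 A i j + A j j]; [i != j] makes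
    this vector nonzero. *)
Lemma posdefmx_offdiag_lt (R : realType) (n : nat) (A : 'M[R]_n) (i j : 'I_n) :
  posdefmx A -> i != j -> A i j + A i j < A i i + A j j.
Proof.
case=> symA posA neq_ij.
have Aji : A j i = A i j by rewrite -[in LHS]symA mxE.
pose v : 'cV[R]_n := delta_mx i 0 - delta_mx j 0.
have v_neq0 : v != 0.
  apply/eqP => /matrixP/(_ i 0); rewrite !mxE !eqxx (negPf neq_ij) subr0.
  by move/eqP; rewrite oner_eq0.
have := posA v v_neq0.
rewrite /v [X in X *m _ *m _]linearB /= !mulmxBl !mulmxBr.
(* Splits only the outer differences: [mxE] on the whole goal would also unfold the products that
   [delta_mx_form] must match. *)
have entryB (B C : 'M[R]_1) : (B - C) 0 0 = B 0 0 - C 0 0 by rewrite !mxE.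
by rewrite !entryB !delta_mx_form Aji; lra.
Qed.

Theorem theorem4p6 (R : realType) (d : Order.disp_t) (P : latticeType d)
    (f : P -> R) (n : nat) (x : 'I_n.+1 -> P) :
  infinite_carrier P ->
  locally_finite P ->
  injective x ->
  (forall i j : 'I_n.+1, (x i <= x j)%O -> (i <= j)%N) ->
  (forall i : 'I_n.+1, (x ord0 <= x i)%O) ->
  is_tree (hasse_graph x) ->
  posdefmx (meet_matrix f x) ->
  (forall i j : 'I_n.+1, (x i < x j)%O -> f (x i) < f (x j)) /\
  (forall i : 'I_n.+1, 0 < f (x i)).
Proof.
move=> _ _ _ _ _ _ posA; split=> [i j lt_ij | i].
  have neq_ij : i != j by apply: contraTneq lt_ij => ->; rewrite ltxx.
  have := posdefmx_offdiag_lt posA neq_ij.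
  (* The inequality becomes [f (x i) + f (x i) < f (x i) + f (x j)], and one [f (x i)] cancels. *)
  by rewrite !mxE !meetxx (meet_l (ltW lt_ij)) ltrD2l.
by have := posdefmx_diag_gt0 i posA; rewrite mxE meetxx.
Qed.
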